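(* Let $P(X) \in \mathbb{S}^{\infty}[\mathbf{A}\cup\{X\}]$. Then $X = P(X)$ has the least solution $P(0)$ and the greatest solution $P(0) + P'(1)^\infty$ in $\mathbb{S}^{\infty}[\mathbf{A}]$.
   Context: $\mathbb{S}^{\infty}[\mathbf{Z}]$ is the semiring of generalized absorptive polynomials over a finite indeterminate set $\mathbf{Z}$: a monomial is a map $m\colon\mathbf{Z}\to\mathbb{N}\cup\{\infty\}$ (multiplication adds exponents); $m_1$ absorbs $m_2$ if $m_1(Y)\le m_2(Y)$ for all $Y$; elements are antichains of monomials w.r.t. absorption; $P+Q$ is the set of absorption-maximal monomials of $P\cup Q$, $P\cdot Q$ the set of maximal monomials among products $m_1m_2$; $0=\emptyset$, $1=\{$constant monomial$\}$. It is absorptive ($1+a=1$) and fully continuous; least/greatest refer to the natural order ($a\le b$ iff $a+b=b$); $a^\infty:=\inf_{n\in\mathbb{N}}a^n$ (infimum w.r.t. the natural order). $\mathbf{A}$ is a finite set of indeterminates and $X\notin\mathbf{A}$; $P(a)$ denotes substitution of $a\in\mathbb{S}^{\infty}[\mathbf{A}]$ for $X$. $P'$ is the partial derivative w.r.t. $X$, defined inductively by $X'=1$, $Y'=0$ for $Y\neq X$, $(PQ)'=P'Q+PQ'$, $(P+Q)'=P'+Q'$, $(P^\infty)'=P^\infty\cdot P'$. *)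

(* Defs.v *)
From HB Require Import structures.
From mathcomp Require Import all_boot all_order all_algebra finmap zify.

Set Implicit Arguments.
Unset Strict Implicit.
Unset Printing Implicit Defensive.

Import GRing.Theory.
Local Open Scope fset_scope.
Local Open Scope ring_scope.

Declare Scope abspoly_scope.
Delimit Scope abspoly_scope with AP.

(* Exponents, N together with an infinite element: [None] is infinity. *)
Definition enat : Type := option nat.
HB.instance Definition _ := Countable.copy enat (option nat).

Definition enat_add (x y : enat) : enat :=
  if x is Some m then if y is Some n then Some (m + n)%N else None else None.

Definition enat_le (x y : enat) : bool :=
  if y is Some n then if x is Some m then (m <= n)%N else false else true.

Fact enat_addA : associative enat_add.
Proof. by case=> [x|] [y|] [z|] //=; rewrite addnA. Qed.
Fact enat_addC : commutative enat_add.
Proof. by case=> [x|] [y|] //=; rewrite addnC. Qed.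
Fact enat_add0 : left_id (Some 0%N : enat) enat_add.
Proof. by case. Qed.
HB.instance Definition _ :=
  GRing.isNmodule.Build enat enat_addA enat_addC enat_add0.

Lemma enat_le_refl x : enat_le x x. Proof. by case: x => /=. Qed.
Lemma enat_le_trans y x z : enat_le x y -> enat_le y z -> enat_le x z.
Proof. by case: x y z => [x|] [y|] [z|] //=; apply: leq_trans. Qed.
Lemma enat_le_anti x y : enat_le x y -> enat_le y x -> x = y.
Proof.
by case: x y => [x|] [y|] //= xy yx; congr Some; apply/eqP; rewrite eqn_leq xy.
Qed.
Lemma enat_leD x x' y y' :
  enat_le x x' -> enat_le y y' -> enat_le (x + y) (x' + y').
Proof. by case: x x' y y' => [x|] [x'|] [y|] [y'|] //=; apply: leq_add. Qed.
Lemma enat_le0 x : enat_le 0 x. Proof. by case: x. Qed.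

(* The product of monomials is the pointwise sum [m1 + m2] of [{ffun Z -> enat}],
   and the constant monomial is [0]. *)
Notation monom Z := {ffun Z -> enat}.

Section AbsPoly.
Variable Z : finType.
Implicit Types (m q : monom Z) (S : {fset monom Z}).

Definition absorbs m1 m2 : bool := [forall Y, enat_le (m1 Y) (m2 Y)].

Definition antichain S : bool :=
  all (fun m1 => all (fun m2 => absorbs m1 m2 ==> (m1 == m2)) S) S.

Definition maximals S : {fset monom Z} :=
  [fset m in S | all (fun m' => absorbs m' m ==> (m' == m)) S].

Lemma absorbs_refl m : absorbs m m.
Proof. by apply/forallP=> Y; apply: enat_le_refl. Qed.
Lemma absorbs_trans q m1 m2 : absorbs m1 q -> absorbs q m2 -> absorbs m1 m2.
Proof.
by move=> /forallP h1 /forallP h2; apply/forallP=> Y; apply: enat_le_trans (h2 Y).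
Qed.
Lemma absorbs_anti m1 m2 : absorbs m1 m2 -> absorbs m2 m1 -> m1 = m2.
Proof.
by move=> /forallP h1 /forallP h2; apply/ffunP=> Y; apply: enat_le_anti.
Qed.
Lemma absorbsD m1 m1' m2 m2' :
  absorbs m1 m1' -> absorbs m2 m2' -> absorbs (m1 + m2) (m1' + m2').
Proof.
by move=> /forallP h1 /forallP h2; apply/forallP=> Y; rewrite !ffunE enat_leD.
Qed.
Lemma absorbs0 m : absorbs 0 m.
Proof. by apply/forallP=> Y; rewrite ffunE enat_le0. Qed.

Lemma maximalsP S m :
  reflect (m \in S /\ {in S, forall m', absorbs m' m -> m' = m})
          (m \in maximals S).
Proof.
rewrite /maximals !inE /=.
apply: (iffP andP) => -[mS h]; split=> //.
  move=> m' m'S a; by apply/eqP; move/allP/(_ _ m'S)/implyP: h; apply.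
by apply/allP=> m' m'S; apply/implyP=> a; rewrite (h _ m'S a).
Qed.

Lemma antichain_maximals S : antichain (maximals S).
Proof.
apply/allP=> m1 /maximalsP[m1S _]; apply/allP=> m2 /maximalsP[_ h].
by apply/implyP=> a; rewrite (h _ m1S a).
Qed.

(* Over a finite set of indeterminates every antichain is finite, since
   absorption is a componentwise product of well-quasi-orders. *)
Record absPoly := AbsPoly { monoms : {fset monom Z}; _ : antichain monoms }.
HB.instance Definition _ := [isSub for monoms].
HB.instance Definition _ := [Choice of absPoly by <:].

Definition normal_form S : absPoly := AbsPoly (antichain_maximals S).

Definition ap_zero : absPoly := normal_form fset0.
Definition ap_one : absPoly := normal_form [fset (0 : monom Z)].
Definition ap_add (P Q : absPoly) : absPoly :=
  normal_form (monoms P `|` monoms Q).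
Definition ap_mul (P Q : absPoly) : absPoly :=
  normal_form [fset m1 + m2 | m1 in monoms P, m2 in monoms Q].

(* [below S m]: m lies in the downward closure of S. *)
Definition below S m : Prop := exists2 m', m' \in S & absorbs m' m.

Lemma below_maximals S m : below (maximals S) m <-> below S m.
Proof.
split=> [[m' /maximalsP[m'S _]]|]; first by exists m'.
case=> m' m'S m'm.
have [k] := ubnP #|` [fset q in S | absorbs q m']|.
elim: k m' m'S m'm => // k IH m' m'S m'm; rewrite ltnS => hk.
have [h|] := boolP (all (fun q => absorbs q m' ==> (q == m')) S).
  by exists m' => //; rewrite /maximals !inE /= m'S.
case/allPn=> q qS; rewrite negb_imply => /andP[qm' qN].
apply: (IH q qS (absorbs_trans qm' m'm)); apply: leq_trans hk.
apply: fproper_ltn_card; rewrite fproperE; apply/andP; split.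
  apply/fsubsetP=> x; by rewrite !inE /= => /andP[-> /absorbs_trans->].
apply/fsubsetPn; exists m'; first by rewrite !inE /= m'S absorbs_refl.
rewrite !inE /= m'S /=; apply: contra qN => m'q.
by apply/eqP/absorbs_anti.
Qed.

Lemma ap_ext (P Q : absPoly) :
  (forall m, below (monoms P) m <-> below (monoms Q) m) -> P = Q.
Proof.
move=> h; apply: val_inj; apply/fsetP=> m.
suff H (P1 Q1 : absPoly) : (forall m, below (monoms P1) m <-> below (monoms Q1) m) ->
    m \in monoms P1 -> m \in monoms Q1.
  by apply/idP/idP; apply: H => // x; split=> /h.
move=> {}h mP; have /h[q qQ qm] : below (monoms P1) m.
  by exists m => //; apply: absorbs_refl.
have /h[m' m'P m'q] : below (monoms Q1) q by exists q => //; apply: absorbs_refl.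
case: P1 {h} mP m'P => /= S /allP hS mS m'S.
move/allP: (hS _ m'S) => /(_ _ mS)/implyP/(_ (absorbs_trans m'q qm))/eqP e.
by rewrite -e in qm *; rewrite (absorbs_anti m'q qm).
Qed.

Lemma below0 m : ~ below (monoms ap_zero) m.
Proof. by move=> /below_maximals[m']; rewrite inE. Qed.
Lemma below1 m : below (monoms ap_one) m.
Proof. by apply/below_maximals; exists 0; rewrite ?inE // absorbs0. Qed.
Lemma belowD P Q m : below (monoms (ap_add P Q)) m <->
  below (monoms P) m \/ below (monoms Q) m.
Proof.
rewrite below_maximals; split=> [[m']|[] [m' h a]].
- by rewrite inE => /orP[] h a; [left|right]; exists m'.
- by exists m'; rewrite // inE h.
- by exists m'; rewrite // inE h orbT.
Qed.
Lemma belowM P Q m : below (monoms (ap_mul P Q)) m <->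
  exists m1 m2, [/\ below (monoms P) m1, below (monoms Q) m2
                  & absorbs (m1 + m2) m].
Proof.
rewrite below_maximals; split=> [[_ /imfset2P[m1 /= h1 [m2 h2 ->]] a]|].
  by exists m1, m2; split=> //; [exists m1|exists m2] => //; apply: absorbs_refl.
case=> m1 [m2] [[n1 h1 a1] [n2 h2 a2] a].
exists (n1 + n2); first by apply: in_imfset2.
exact: absorbs_trans (absorbsD a1 a2) a.
Qed.

Fact ap_addA : associative ap_add.
Proof. by move=> P Q R; apply: ap_ext=> m; rewrite !belowD; tauto. Qed.
Fact ap_addC : commutative ap_add.
Proof. by move=> P Q; apply: ap_ext=> m; rewrite !belowD; tauto. Qed.
Fact ap_add0 : left_id ap_zero ap_add.
Proof. by move=> P; apply: ap_ext=> m; rewrite !belowD; have := @below0 m; tauto. Qed.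
Fact ap_mulC : commutative ap_mul.
Proof.
move=> P Q; apply: ap_ext=> m; rewrite !belowM.
by split=> -[m1 [m2 [h1 h2 a]]]; exists m2, m1; rewrite addrC.
Qed.
Fact ap_mulA : associative ap_mul.
Proof.
move=> P Q R; apply: ap_ext=> m; rewrite !belowM; split.
  move=> [m1 [m23 [h1 /belowM[m2 [m3 [h2 h3 a1]]] a]]].
  exists (m1 + m2), m3; split=> //.
    by apply/belowM; exists m1, m2; split=> //; apply: absorbs_refl.
  by rewrite -addrA; apply: absorbs_trans (absorbsD (absorbs_refl _) a1) a.
move=> [m12 [m3 [/belowM[m1 [m2 [h1 h2 a1]]] h3 a]]].
exists m1, (m2 + m3); split=> //.
  by apply/belowM; exists m2, m3; split=> //; apply: absorbs_refl.
by rewrite addrA; apply: absorbs_trans (absorbsD a1 (absorbs_refl _)) a.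
Qed.
Fact ap_mul1 : left_id ap_one ap_mul.
Proof.
move=> P; apply: ap_ext=> m; rewrite belowM; split.
  move=> [m1 [m2 [_ [q qP qm2] a]]]; exists q => //.
  apply: absorbs_trans a; rewrite -[q]add0r.
  by apply: absorbsD; first apply: absorbs0.
move=> h; exists 0, m; split=> //; first exact: below1.
by rewrite add0r absorbs_refl.
Qed.
Fact ap_mulDl : left_distributive ap_mul ap_add.
Proof.
move=> P Q R; apply: ap_ext=> m; rewrite belowD !belowM; split.
  by move=> [m1 [m2 [/belowD[] h1 h2 a]]]; [left|right]; exists m1, m2.
by move=> [] [m1 [m2 [h1 h2 a]]]; exists m1, m2; split=> //; apply/belowD; tauto.
Qed.
Fact ap_mul0 : left_zero ap_zero ap_mul.
Proof.
move=> P; apply: ap_ext=> m; rewrite belowM; split=> [[m1 [m2 [h _ _]]]|h].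
  by case: (below0 h).
by case: (below0 h).
Qed.
Fact ap_one_neq0 : ap_one != ap_zero.
Proof. by apply/eqP=> e; apply: (@below0 0); rewrite -e; apply: below1. Qed.

HB.instance Definition _ :=
  GRing.isNmodule.Build absPoly ap_addA ap_addC ap_add0.
HB.instance Definition _ := GRing.Nmodule_isComNzSemiRing.Build absPoly
  ap_mulA ap_mulC ap_mul1 ap_mulDl ap_mul0 ap_one_neq0.

Definition natural_le (a b : absPoly) : Prop := a + b = b.

Definition is_inf (u : nat -> absPoly) (b : absPoly) : Prop :=
  (forall n, natural_le b (u n)) /\
  (forall c, (forall n, natural_le c (u n)) -> natural_le c b).

Definition monom_poly m : absPoly := normal_form [fset m].
Definition var (Y : Z) : absPoly :=
  monom_poly [ffun Y' => Some (Y' == Y : nat)].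

Lemma natural_leP a b :
  natural_le a b <-> forall m, below (monoms a) m -> below (monoms b) m.
Proof.
split=> [<- m h|h]; first by apply/belowD; left.
by apply: ap_ext=> m; rewrite belowD; have := h m; tauto.
Qed.
Lemma natural_le_anti a b : natural_le a b -> natural_le b a -> a = b.
Proof. by move=> ab ba; rewrite -[LHS]ba addrC. Qed.
Lemma is_inf_unique u b c : is_inf u b -> is_inf u c -> b = c.
Proof. by move=> [b1 b2] [c1 c2]; apply: natural_le_anti; auto. Qed.

Definition monom_inf m : monom Z :=
  [ffun Y => if m Y == 0 then Some 0%N else None].

Lemma monom_infD m n : absorbs (m *+ n) (monom_inf m).
Proof.
apply/forallP=> Y; rewrite ffunE; case: eqP => // mY0.
suff -> : (m *+ n) Y = 0 by [].
by elim: n => [|n IH]; rewrite ?mulr0n ?mulrS ffunE // IH mY0 addr0.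
Qed.

Lemma below_exp (a : absPoly) m n :
  m \in monoms a -> below (monoms (a ^+ n)) (m *+ n).
Proof.
move=> ma; elim: n => [|n IH]; first exact: below1.
rewrite exprS; apply/belowM; exists m, (m *+ n); split=> //.
  by exists m => //; apply: absorbs_refl.
by rewrite mulrS absorbs_refl.
Qed.

Lemma is_inf_exp (a : absPoly) :
  is_inf (fun n => a ^+ n) (normal_form [fset monom_inf m | m in monoms a]).
Proof.
split=> [n|c hc]; apply/natural_leP=> q.
  move=> /below_maximals[_ /imfsetP[m /= ma ->] mq].
  have [q' q'a q'm] := below_exp n ma; exists q' => //.
  by apply: absorbs_trans (absorbs_trans _ _) mq; [exact: q'm|exact: monom_infD].
move=> hq; apply/below_maximals.
have {hc} hq n : below (monoms (a ^+ n)) q by have /natural_leP := hc n; apply.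
have [/hasP[m ma mq]|/hasPn no] :=
    boolP (has (fun m => absorbs (monom_inf m) q) (monoms a)).
  by exists (monom_inf m) => //; apply/imfsetP; exists m.
exfalso.
pose w m := (\sum_(Y : Z | q Y != None) odflt 0%N (m Y))%N.
pose bnd m := [forall Y, (q Y != None) ==> (m Y != None)].
have bndA m : absorbs m q -> bnd m /\ (w m <= w q)%N.
  move=> /forallP h; split.
    by apply/forallP=> Y; apply/implyP; move: (h Y); case: (q Y) (m Y) => [?|] [?|].
  by apply: leq_sum => Y; move: (h Y); case: (q Y) (m Y) => [?|] [?|].
have key n m : below (monoms (a ^+ n)) m -> bnd m -> (n <= w m)%N.
  elim: n m => [|n IH] m // ; rewrite exprS.
  move=> /belowM[m1 [m2 [[m0 m0a m01] h2 /forallP a12]]] /forallP bm.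
  have b2 : bnd m2.
    apply/forallP=> Y; have := bm Y; have := a12 Y; rewrite ffunE.
    by case: (q Y) (m Y) (m1 Y) (m2 Y) => [?|] [?|] [?|] [?|].
  have := IH _ h2 b2; suff : (0 < w m1)%N /\ (w m1 + w m2 <= w m)%N by lia.
  split; last first.
    rewrite -big_split; apply: leq_sum => Y qY.
    have := bm Y; have := a12 Y; rewrite ffunE qY /=.
    by case: (m Y) (m1 Y) (m2 Y) => [?|] [?|] [?|].
  have /forallPn[Y] := no _ m0a; rewrite ffunE.
  case: (m0 Y =P 0) => [_|mY0 qY]; first by case: (q Y).
  have qYN : q Y != None by case: (q Y) qY.
  rewrite /w (bigD1 Y) //= addn_gt0; apply/orP; left.
  have := bm Y; have := a12 Y; rewrite ffunE qYN /=.
  move/forallP/(_ Y): m01 => m01.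
  case: (m0 Y) (m1 Y) (m2 Y) (m Y) mY0 m01 => [[|?]|] [[|?]|] [?|] [?|] //=.
have [q' q'a q'q] := hq (w q).+1.
have [bq wq] := bndA _ q'q.
have /key/(_ bq) : below (monoms (a ^+ (w q).+1)) q'.
  by exists q' => //; apply: absorbs_refl.
by lia.
Qed.

Lemma inf_exp_exists (a : absPoly) : {b | is_inf (fun n => a ^+ n) b}.
Proof.
by exists (normal_form [fset monom_inf m | m in monoms a]); apply: is_inf_exp.
Qed.

Definition inf_exp (a : absPoly) : absPoly := sval (inf_exp_exists a).

Lemma inf_expP a : is_inf (fun n => a ^+ n) (inf_exp a).
Proof. exact: svalP. Qed.

Definition eexp (a : absPoly) (e : enat) : absPoly :=
  if e is Some n then a ^+ n else inf_exp a.

End AbsPoly.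

Notation "a ^oo" := (inf_exp a) (at level 1, format "a ^oo") : abspoly_scope.
Notation "a <=s b" := (natural_le a b) (at level 70) : abspoly_scope.
Local Open Scope abspoly_scope.

(* Substitution of f Y for each Y. *)
Definition subst (Z Z' : finType) (f : Z -> absPoly Z') (P : absPoly Z) :
    absPoly Z' :=
  \sum_(m <- monoms P) \prod_Y eexp (f Y) (m Y).

(* The indeterminates of [absPoly (option A)] are those of A, as [Some Y], and a
   fresh X, which is [None]. *)
Definition eval (A : finType) (P : absPoly (option A)) (a : absPoly A) :
    absPoly A :=
  subst (fun Y => if Y is Some Y' then var Y' else a) P.

(* The rules do not define a function of P, because they do not respect
   absorption: 1 + X = 1, yet they give 0 + 1 = 1 from the left-hand side and 0
   from the right-hand side.  [is_deriv X P D] says that D is obtained by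
   the rules from some expression of P; constants have derivative 0. *)
Inductive is_deriv (Z : finType) (X : Z) : absPoly Z -> absPoly Z -> Prop :=
| is_deriv0 : is_deriv X 0 0
| is_deriv1 : is_deriv X 1 0
| is_derivX : is_deriv X (var X) 1
| is_derivY Y : Y != X -> is_deriv X (var Y) 0
| is_derivM P P' Q Q' : is_deriv X P P' -> is_deriv X Q Q' ->
    is_deriv X (P * Q) (P' * Q + P * Q')
| is_derivD P P' Q Q' : is_deriv X P P' -> is_deriv X Q Q' ->
    is_deriv X (P + Q) (P' + Q')
| is_deriv_oo P P' : is_deriv X P P' -> is_deriv X P^oo (P^oo * P').

Lemma monom_polyD (Z : finType) (m1 m2 : monom Z) :
  monom_poly (m1 + m2) = monom_poly m1 * monom_poly m2.
Proof.
apply: ap_ext=> m; rewrite belowM below_maximals; split.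
  move=> [_ /fset1P-> h]; exists m1, m2; split=> //; apply/below_maximals.
    by exists m1; rewrite ?inE ?absorbs_refl.
  by exists m2; rewrite ?inE ?absorbs_refl.
move=> [n1 [n2 [/below_maximals[_ /fset1P-> h1] /below_maximals[_ /fset1P-> h2] h]]].
by exists (m1 + m2); rewrite ?inE //; apply: absorbs_trans (absorbsD h1 h2) h.
Qed.

Lemma monom_poly_inf (Z : finType) (m : monom Z) :
  (monom_poly m)^oo = monom_poly (monom_inf m).
Proof.
apply: is_inf_unique (inf_expP _) _.
have := is_inf_exp (monom_poly m); congr is_inf; congr normal_form.
apply/fsetP=> q; rewrite inE; apply/imfsetP/eqP => [[_ /maximalsP[/fset1P-> _] //]|->].
exists m => //; apply/maximalsP; split; first exact/fset1P.
by move=> _ /fset1P->.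
Qed.

Lemma eexp_var (Z : finType) (Y : Z) (e : enat) :
  eexp (var Y) e = monom_poly [ffun Y' => if Y' == Y then e else 0].
Proof.
case: e => [n|] /=; last first.
  rewrite monom_poly_inf; congr monom_poly.
  by apply/ffunP=> Y'; rewrite !ffunE; case: (Y' == Y).
elim: n => [|n IH].
  by congr monom_poly; apply/ffunP=> Y'; rewrite !ffunE; case: (Y' == Y).
rewrite exprS IH -monom_polyD; congr monom_poly.
by apply/ffunP=> Y'; rewrite !ffunE; case: (Y' == Y).
Qed.

Lemma abspolyE (Z : finType) (P : absPoly Z) : subst (@var Z) P = P.
Proof.
have prodE (m : monom Z) : \prod_Y eexp (var Y) (m Y) = monom_poly m.
  under eq_bigr do rewrite eexp_var.
  rewrite -(big_morph (@monom_poly Z) (@monom_polyD Z) (erefl 1)).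
  congr monom_poly; apply/ffunP=> Y; rewrite sum_ffunE (bigD1 Y) //= ffunE eqxx.
  by rewrite big1 ?addr0 // => Y' YY'; rewrite ffunE eq_sym (negPf YY').
have belowS (s : seq (monom Z)) q :
    below (monoms (\sum_(m <- s) monom_poly m)) q <-> exists2 m, m \in s & absorbs m q.
  elim: s => [|m s IH].
    by rewrite big_nil; split=> [/below0|[]].
  rewrite big_cons belowD IH below_maximals; split.
    move=> [[_ /fset1P-> h]|[m' h a]]; first by exists m => //; apply: mem_head.
    by exists m' => //; rewrite in_cons h orbT.
  move=> [m']; rewrite in_cons => /orP[/eqP->|h] a; last by right; exists m'.
  by left; exists m => //; apply/fset1P.
rewrite /subst (eq_bigr _ (fun m _ => prodE m)).
by apply: ap_ext=> q; rewrite belowS.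
Qed.

Lemma is_deriv_exists (Z : finType) (X : Z) (P : absPoly Z) :
  exists P', is_deriv X P P'.
Proof.
rewrite -(abspolyE P) /subst.
pose K Q := exists Q', is_deriv X Q Q'.
apply: (big_ind K) => [|Q R [Q' h] [R' h']|m _].
- by exists 0; exact: is_deriv0.
- by exists (Q' + R'); exact: is_derivD.
have KM Q R : K Q -> K R -> K (Q * R).
  by move=> [Q' h] [R' h']; exists (Q' * R + Q * R'); exact: is_derivM.
have K1 : K 1 by exists 0; exact: is_deriv1.
apply: (big_ind K) => // Y _.
have KY : K (var Y).
  have [->|YX] := eqVneq Y X; first by exists 1; exact: is_derivX.
  by exists 0; exact: is_derivY.
case: (m Y) => [n|] /=; last by case: KY => D h; exists ((var Y)^oo * D); exact: is_deriv_oo.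
by elim: n => [|n IH] //; rewrite exprS; apply: KM.
Qed.

Definition least_solution (A : finType) (P : absPoly (option A))
    (s : absPoly A) : Prop :=
  s = eval P s /\ forall t, t = eval P t -> s <=s t.

Definition greatest_solution (A : finType) (P : absPoly (option A))
    (s : absPoly A) : Prop :=
  s = eval P s /\ forall t, t = eval P t -> t <=s s.

(* Main.v *)
(* The derivative enters only through the identity P(1) = P(0) + P'(1), which
   holds for every expression of P although P' itself depends on the expression.
   As a |-> a^oo is additive and P(0)^oo <= P(0), it gives
   P(0) + P'(1)^oo = P(0) + P(1)^oo.
   Absorption bounds a monomial c X^e with e > 0 at t by c t, so
   P(t) <= P(0) + t P(1). This makes P(0) a fixed point, and iterating it on
   t = P(t) gives t <= P(0) + P(1)^n for all n, hence t <= P(0) + P(1)^oo.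
   The latter is a fixed point because each monomial c X^e with e > 0 maps c^oo
   to itself. *)
Require Import Defs.
From mathcomp Require Import all_boot all_order all_algebra finmap.

Set Implicit Arguments.
Unset Strict Implicit.
Unset Printing Implicit Defensive.

Import GRing.Theory.
Local Open Scope ring_scope.
Local Open Scope abspoly_scope.

(** * The natural order of an absorptive semiring *)

Section NaturalOrder.
Variable Z : finType.
Implicit Types (a b c d : absPoly Z) (m : monom Z).

Lemma natural_le_refl a : a <=s a.
Proof. exact/natural_leP. Qed.

Lemma natural_le_trans b a c : a <=s b -> b <=s c -> a <=s c.
Proof. by move=> /natural_leP ab /natural_leP bc; apply/natural_leP; auto. Qed.

Lemma natural_le0 a : 0 <=s a.
Proof. by rewrite /natural_le add0r. Qed.

(** Absorptivity in order form; with monotone multiplication it puts every product below each of its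
    factors. *)
Lemma natural_le1 a : a <=s 1.
Proof. by apply/natural_leP=> m _; apply: below1. Qed.

Lemma natural_le_addl a b : a <=s a + b.
Proof. by apply/natural_leP=> m h; apply/belowD; left. Qed.

Lemma natural_le_addr a b : b <=s a + b.
Proof. by rewrite addrC; apply: natural_le_addl. Qed.

Lemma natural_le_lub a b c : a <=s c -> b <=s c -> a + b <=s c.
Proof.
move=> /natural_leP ac /natural_leP bc; apply/natural_leP=> m.
by case/belowD; auto.
Qed.

Lemma natural_leD a b c d : a <=s b -> c <=s d -> a + c <=s b + d.
Proof.
move=> ab cd; apply: natural_le_lub.
  exact: natural_le_trans ab (natural_le_addl _ _).
exact: natural_le_trans cd (natural_le_addr _ _).
Qed.

Lemma natural_leM a b c d : a <=s b -> c <=s d -> a * c <=s b * d.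
Proof.
move=> /natural_leP ab /natural_leP cd; apply/natural_leP=> m.
by move=> /belowM[m1 [m2 [h1 h2 h]]]; apply/belowM; exists m1, m2; split; auto.
Qed.

Lemma natural_le_mull a b : a * b <=s a.
Proof.
by have := natural_leM (natural_le_refl a) (natural_le1 b); rewrite mulr1.
Qed.

Lemma natural_le_mulr a b : a * b <=s b.
Proof. by rewrite mulrC; apply: natural_le_mull. Qed.

Lemma natural_leX n a b : a <=s b -> a ^+ n <=s b ^+ n.
Proof.
move=> ab; elim: n => [|n IH]; first exact: natural_le_refl.
by rewrite !exprS; apply: natural_leM.
Qed.

Lemma natural_le_sum (I : eqType) (s : seq I) (F : I -> absPoly Z) c :
  (forall i, i \in s -> F i <=s c) -> \sum_(i <- s) F i <=s c.
Proof.
elim: s => [|i s IH] h; first by rewrite big_nil; apply: natural_le0.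
rewrite big_cons; apply: natural_le_lub; first by apply: h; rewrite mem_head.
by apply: IH => j js; apply: h; rewrite inE js orbT.
Qed.

Lemma natural_le_sum_sup (I : eqType) (s : seq I) (F : I -> absPoly Z) i :
  i \in s -> F i <=s \sum_(j <- s) F j.
Proof.
elim: s => [//|j s IH]; rewrite inE big_cons => /orP[/eqP->|/IH h].
  exact: natural_le_addl.
exact: natural_le_trans h (natural_le_addr _ _).
Qed.

Lemma below_monoms a m : m \in monoms a -> below (monoms a) m.
Proof. by exists m => //; apply: absorbs_refl. Qed.

Lemma below_trans a m1 m2 :
  below (monoms a) m1 -> absorbs m1 m2 -> below (monoms a) m2.
Proof. by case=> m ma /absorbs_trans h /h; exists m. Qed.

End NaturalOrder.

(** * Infinitary powers and exponents in [enat] *)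

Section InfinitePower.
Variable Z : finType.
Implicit Types (a b c : absPoly Z) (m : monom Z).

(** [monom_inf m] depends only on the support of [m], and an absorbed monomial has the larger
    support. *)
Lemma absorbs_monom_inf m1 m2 :
  absorbs m1 m2 -> absorbs (monom_inf m1) (monom_inf m2).
Proof.
move=> /forallP h; apply/forallP=> Y; rewrite !ffunE.
by move: (h Y); case: (m1 Y) (m2 Y) => [[|?]|] [[|?]|].
Qed.

Lemma monom_inf_add m1 m2 : monom_inf (m1 + m2) = monom_inf m1 + monom_inf m2.
Proof.
by apply/ffunP=> Y; rewrite !ffunE; case: (m1 Y) (m2 Y) => [[|?]|] [[|?]|].
Qed.

Lemma monom_inf_addl m : m + monom_inf m = monom_inf m.
Proof. by apply/ffunP=> Y; rewrite !ffunE; case: (m Y) => [[|?]|]. Qed.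

Lemma monom_infK m : monom_inf (monom_inf m) = monom_inf m.
Proof. by apply/ffunP=> Y; rewrite !ffunE; case: (m Y) => [[|?]|]. Qed.

Lemma below_inf_exp a m : below (monoms a^oo) m <->
  exists2 q, below (monoms a) q & absorbs (monom_inf q) m.
Proof.
rewrite (is_inf_unique (inf_expP a) (is_inf_exp a)) below_maximals; split.
  move=> [_ /imfsetP[q /= qa ->] h]; exists q => //; exact: below_monoms.
move=> [q [q' q'a q'q] h]; exists (monom_inf q').
  by apply/imfsetP; exists q'.
exact: absorbs_trans (absorbs_monom_inf q'q) h.
Qed.

(** A monomial below every power is, as a one-element polynomial, a lower bound of all powers, so
    the infimum dominates it. *)
Lemma below_inf_expX a m :
  below (monoms a^oo) m <-> forall n, below (monoms (a ^+ n)) m.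
Proof.
have [lb glb] := inf_expP a; split=> [h n|h].
  by move/natural_leP: (lb n); apply.
have /natural_leP : monom_poly m <=s a^oo.
  apply: glb => n; apply/natural_leP=> q /below_maximals[_ /fset1P-> mq].
  exact: below_trans mq.
apply; apply/below_maximals; exists m; last exact: absorbs_refl.
exact/fset1P.
Qed.

Lemma inf_exp_leX a n : a^oo <=s a ^+ n.
Proof. by have [h _] := inf_expP a. Qed.

Lemma inf_exp_le a : a^oo <=s a.
Proof. exact: inf_exp_leX 1%N. Qed.

(** By [below_inf_exp], each monomial of the closure is dominated by the infinitary power of a
    single monomial, so mixed products of [a] and [b] contribute nothing new. *)
Lemma inf_expD a b : (a + b)^oo = a^oo + b^oo.
Proof.
apply: ap_ext=> m; rewrite belowD !below_inf_exp; split.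
  by move=> [q /belowD[] h hm]; [left|right]; exists q.
by move=> [] [q h hm]; exists q => //; apply/belowD; tauto.
Qed.

Lemma inf_exp_mono a b : a <=s b -> a^oo <=s b^oo.
Proof. by move=> ab; rewrite -ab inf_expD; apply: natural_le_addl. Qed.

Lemma inf_exp0 : (0 : absPoly Z)^oo = 0.
Proof. by apply: natural_le_anti; [apply: inf_exp_le|apply: natural_le0]. Qed.

Lemma inf_exp1 : (1 : absPoly Z)^oo = 1.
Proof.
apply: natural_le_anti; first exact: inf_exp_le.
apply/natural_leP=> m h; apply/below_inf_expX=> n; by rewrite expr1n.
Qed.

Lemma inf_expM a b : (a * b)^oo = a^oo * b^oo.
Proof.
apply: ap_ext=> m; rewrite belowM below_inf_exp; split.
  move=> [q /belowM[m1 [m2 [h1 h2 /absorbs_monom_inf h]]] hm].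
  rewrite monom_inf_add in h.
  exists (monom_inf m1), (monom_inf m2); split.
  - by apply/below_inf_exp; exists m1 => //; apply: absorbs_refl.
  - by apply/below_inf_exp; exists m2 => //; apply: absorbs_refl.
  - exact: absorbs_trans h hm.
move=> [m1 [m2 [/below_inf_exp[q1 h1 a1] /below_inf_exp[q2 h2 a2] h]]].
exists (q1 + q2).
  by apply/belowM; exists q1, q2; split=> //; apply: absorbs_refl.
by rewrite monom_inf_add; apply: absorbs_trans (absorbsD a1 a2) h.
Qed.

Lemma mulr_inf_exp a : a * a^oo = a^oo.
Proof.
apply: natural_le_anti; first exact: natural_le_mulr.
apply/natural_leP=> m /below_inf_exp[q h hm]; apply/belowM.
exists q, (monom_inf q); rewrite monom_inf_addl; split=> //.
by apply/below_inf_exp; exists q => //; apply: absorbs_refl.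
Qed.

Lemma inf_expK a : (a^oo)^oo = a^oo.
Proof.
apply: natural_le_anti; first exact: inf_exp_le.
apply/natural_leP=> m /below_inf_exp[q h hm]; apply/below_inf_exp.
exists (monom_inf q); last by rewrite monom_infK.
by apply/below_inf_exp; exists q => //; apply: absorbs_refl.
Qed.

Lemma inf_exp_idem a : a^oo * a^oo = a^oo.
Proof. by rewrite -{2 3}[a^oo]inf_expK mulr_inf_exp. Qed.

Lemma inf_expX a n : (a ^+ n.+1)^oo = a^oo.
Proof.
elim: n => [//|n IH]; by rewrite exprS inf_expM IH inf_exp_idem.
Qed.

Lemma inf_exp_sum (I : Type) (s : seq I) (F : I -> absPoly Z) :
  (\sum_(i <- s) F i)^oo = \sum_(i <- s) (F i)^oo.
Proof. exact: (big_morph _ inf_expD inf_exp0). Qed.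

Lemma mulXr_inf_exp a n : a ^+ n * a^oo = a^oo.
Proof.
by elim: n => [|n IH]; rewrite ?mul1r // exprS -mulrA IH mulr_inf_exp.
Qed.

Lemma le_add_inf_exp a b c :
  (forall n, a <=s b + c ^+ n) -> a <=s b + c^oo.
Proof.
move=> h; apply/natural_leP=> m am; apply/belowD.
(* Whether [m] lies below [b] does not depend on [n]; if it does not, [m] lies below every
   [c ^+ n]. *)
have [bm|bm] := boolP (has (fun q => absorbs q m) (monoms b)).
  by left; case/hasP: bm => q qb qm; exists q.
right; apply/below_inf_expX=> n; move/natural_leP: (h n) => /(_ _ am).
case/belowD=> // -[q qb qm]; case/negP: bm; apply/hasP; by exists q.
Qed.

Lemma eexpD a e f : eexp a (e + f) = eexp a e * eexp a f.
Proof.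
case: e f => [n|] [k|] /=; rewrite ?inf_exp_idem ?mulXr_inf_exp ?exprD //.
by rewrite mulrC mulXr_inf_exp.
Qed.

Lemma eexp_anti a e f : enat_le e f -> eexp a f <=s eexp a e.
Proof.
case: e f => [n|] [k|] //=; last by move=> _; apply: natural_le_refl.
  by move=> /subnK<-; rewrite exprD; apply: natural_le_mulr.
by move=> _; apply: inf_exp_leX.
Qed.

Lemma eexp_mono a b e : a <=s b -> eexp a e <=s eexp b e.
Proof. by case: e => [n|]; [apply: natural_leX|apply: inf_exp_mono]. Qed.

Lemma eexp1 e : eexp (1 : absPoly Z) e = 1.
Proof. by case: e => [n|] /=; rewrite ?expr1n ?inf_exp1. Qed.

Lemma eexp0 a : eexp a 0 = 1.
Proof. exact: expr0. Qed.

Lemma eexp_le a e : e != 0 -> eexp a e <=s a.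
Proof. by move=> e0; apply: (@eexp_anti a (Some 1%N)); case: e e0 => [[]|]. Qed.

Lemma inf_exp_eexp a e :
  (eexp a e)^oo = eexp a (if e == 0 then Some 0%N else None).
Proof. by case: e => [[|n]|] /=; rewrite ?inf_exp1 ?inf_expX ?inf_expK. Qed.

Lemma eexp_inf_exp a e : e != 0 -> eexp a^oo e = a^oo.
Proof.
case: e => [[//|n]|] _ /=; last exact: inf_expK.
by elim: n => [|n IH] //; rewrite exprS IH inf_exp_idem.
Qed.

(** The product rule for finite differences: expanding the left side leaves [a0 * db], which may be
    enlarged to [a * db] because every summand on the right stays below [a * b]. *)
Lemma add_eq_mul a a0 da b b0 db :
  a = a0 + da -> b = b0 + db -> a * b = a0 * b0 + (da * b + a * db).
Proof.
move=> aE bE.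
have [a0a daa] : a0 <=s a /\ da <=s a.
  by rewrite aE; split; [apply: natural_le_addl|apply: natural_le_addr].
have [b0b dbb] : b0 <=s b /\ db <=s b.
  by rewrite bE; split; [apply: natural_le_addl|apply: natural_le_addr].
have [ra rb] := (natural_le_refl a, natural_le_refl b).
apply: natural_le_anti; last first.
  apply: natural_le_lub; first exact: natural_leM.
  by apply: natural_le_lub; apply: natural_leM.
rewrite {1}aE mulrDl {1}bE mulrDr; apply: natural_le_lub; last first.
  exact: natural_le_trans (natural_le_addl _ _) (natural_le_addr _ _).
apply: natural_leD; first exact: natural_le_refl.
apply: natural_le_trans (natural_le_addr _ _).
exact: natural_leM (natural_le_refl _).
Qed.

(** The analogous rule for infinitary powers: additivity leaves [da^oo], which equals [da^oo * da]
    and so lies below [a^oo * da]. *)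
Lemma add_eq_inf_exp a a0 da : a = a0 + da -> a^oo = a0^oo + a^oo * da.
Proof.
move=> aE; apply: natural_le_anti.
  rewrite {1}aE inf_expD; apply: natural_leD; first exact: natural_le_refl.
  rewrite -mulr_inf_exp mulrC; apply: natural_leM (natural_le_refl _).
  by apply: inf_exp_mono; rewrite aE; apply: natural_le_addr.
apply: natural_le_lub; last exact: natural_le_mull.
by apply: inf_exp_mono; rewrite aE; apply: natural_le_addl.
Qed.

End InfinitePower.

(** * Substitution as a homomorphism that preserves infinitary powers *)

Section Substitution.
Variables (Z Z' : finType) (f : Z -> absPoly Z').
Implicit Types (P Q : absPoly Z) (m : monom Z).

Definition subst_monom m : absPoly Z' := \prod_Y eexp (f Y) (m Y).

Lemma subst_monomD m1 m2 :
  subst_monom (m1 + m2) = subst_monom m1 * subst_monom m2.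
Proof.
rewrite /subst_monom -big_split; apply: eq_bigr => Y _ /=.
by rewrite ffunE eexpD.
Qed.

Lemma subst_monom_anti m1 m2 :
  absorbs m1 m2 -> subst_monom m2 <=s subst_monom m1.
Proof.
move=> /forallP h; rewrite /subst_monom.
apply: (big_ind2 (@natural_le Z')) => [||Y _]; first exact: natural_le_refl.
  by move=> *; apply: natural_leM.
exact: eexp_anti.
Qed.

Lemma subst_monom_inf m : subst_monom (monom_inf m) = (subst_monom m)^oo.
Proof.
rewrite /subst_monom (big_morph _ (@inf_expM Z') (inf_exp1 Z')).
by apply: eq_bigr => Y _; rewrite ffunE inf_exp_eexp.
Qed.

(** Together with [subst_le] this makes [subst f P] a supremum over the whole downward closure of
    [P], so the homomorphism laws need no reasoning about maximal monomials. *)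
Lemma subst_ge P m : below (monoms P) m -> subst_monom m <=s subst f P.
Proof.
move=> [q qP qm]; apply: natural_le_trans (subst_monom_anti qm) _.
exact: natural_le_sum_sup.
Qed.

Lemma subst_le P c :
  (forall m, below (monoms P) m -> subst_monom m <=s c) -> subst f P <=s c.
Proof. by move=> h; apply: natural_le_sum => m /below_monoms /h. Qed.

Lemma subst0 : subst f 0 = 0.
Proof.
apply: natural_le_anti; last exact: natural_le0.
by apply: subst_le => m /below0.
Qed.

Lemma subst_monom_poly m : subst f (monom_poly m) = subst_monom m.
Proof.
apply: natural_le_anti.
  apply: subst_le => q /below_maximals[_ /fset1P-> mq].
  exact: subst_monom_anti.
apply: subst_ge; apply/below_maximals; exists m; last exact: absorbs_refl.
exact/fset1P.
Qed.

Lemma subst1 : subst f 1 = 1.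
Proof.
by rewrite subst_monom_poly /subst_monom big1 // => Y _; rewrite ffunE.
Qed.

Lemma subst_var Y : subst f (var Y) = f Y.
Proof.
rewrite subst_monom_poly /subst_monom (bigD1 Y) //= ffunE eqxx big1 ?mulr1 //.
by move=> Y' YY'; rewrite ffunE (negPf YY').
Qed.

Lemma substD P Q : subst f (P + Q) = subst f P + subst f Q.
Proof.
apply: natural_le_anti.
  apply: subst_le => m /belowD[] /subst_ge h; apply: natural_le_trans h _.
    exact: natural_le_addl.
  exact: natural_le_addr.
by apply: natural_le_lub; apply: subst_le => m h; apply: subst_ge;
  apply/belowD; tauto.
Qed.

Lemma substM P Q : subst f (P * Q) = subst f P * subst f Q.
Proof.
apply: natural_le_anti.
  apply: subst_le => m /belowM[m1 [m2 [h1 h2 /subst_monom_anti h]]].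
  apply: natural_le_trans h _; rewrite subst_monomD.
  by apply: natural_leM; apply: subst_ge.
rewrite {1}/subst mulr_suml; apply: natural_le_sum => m1 h1.
rewrite {1}/subst mulr_sumr; apply: natural_le_sum => m2 h2.
rewrite -!/(subst_monom _) -subst_monomD; apply: subst_ge; apply/belowM.
by exists m1, m2; split; [exact: below_monoms..|exact: absorbs_refl].
Qed.

(** Infinitary powers commute with sums and products, which reduces the claim to single
    monomials. *)
Lemma subst_inf_exp P : subst f P^oo = (subst f P)^oo.
Proof.
apply: natural_le_anti.
  apply: subst_le => m /below_inf_exp[q h /subst_monom_anti hm].
  apply: natural_le_trans hm _; rewrite subst_monom_inf.
  exact/inf_exp_mono/subst_ge.
rewrite {1}/subst inf_exp_sum; apply: natural_le_sum => m h.
rewrite -/(subst_monom _) -subst_monom_inf; apply: subst_ge.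
apply/below_inf_exp; exists m; first exact: below_monoms.
exact: absorbs_refl.
Qed.

End Substitution.

(** * Evaluation at X, the derivative, and the extremal solutions *)

Section Evaluation.
Variable A : finType.
Implicit Types (P D : absPoly (option A)) (t : absPoly A).

Definition eval_monom (m : monom (option A)) t : absPoly A :=
  subst_monom (fun Y => if Y is Some Y' then var Y' else t) m.

Lemma eval_monomE m :
  exists c, forall t, eval_monom m t = eexp t (m None) * c.
Proof.
(* The coefficient is the X-free part of [m]; the product skips [None], so [0] is a placeholder
   there. *)
exists (\prod_(Y | Y != None)
  eexp (if Y is Some Y' then var Y' else 0) (m Y)) => t.
rewrite /eval_monom /subst_monom (bigD1 None) //=; congr (_ * _).
by apply: eq_bigr => -[Y|].
Qed.

Lemma eval_mono P s t : s <=s t -> eval P s <=s eval P t.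
Proof.
move=> st; apply: subst_le => m mP.
apply: natural_le_trans (subst_ge _ mP); rewrite -!/(eval_monom _ _).
have [c cE] := eval_monomE m; rewrite !cE.
by apply: natural_leM; [apply: eexp_mono|apply: natural_le_refl].
Qed.

Lemma eval_le_affine P t : eval P t <=s eval P 0 + t * eval P 1.
Proof.
apply: subst_le => m mP; rewrite -/(eval_monom m t).
have h0 : eval_monom m 0 <=s eval P 0 by apply: subst_ge.
have h1 : eval_monom m 1 <=s eval P 1 by apply: subst_ge.
have [c cE] := eval_monomE m; move: h0 h1; rewrite !cE eexp1 mul1r.
(* A monomial free of X has the same value at [t] as at 0; otherwise one factor [t] bounds the power
   of X. *)
have [->|e0] := eqVneq (m None) 0 => h0 h1.
  exact: natural_le_trans h0 (natural_le_addl _ _).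
apply: natural_le_trans (natural_le_addr _ _).
by apply: natural_leM => //; apply: eexp_le.
Qed.

Lemma inf_exp_eval1_le P :
  (eval P 1)^oo <=s eval P 0 + eval P (eval P 1)^oo.
Proof.
(* At X = 1 a monomial [c X^e] contributes [c], so it suffices to bound each [c^oo] separately. *)
have wE : (eval P 1)^oo = \sum_(m <- monoms P) (eval_monom m 1)^oo.
  exact: inf_exp_sum.
rewrite {1}wE {wE}; apply: natural_le_sum => m /below_monoms mP.
have h0 : eval_monom m 0 <=s eval P 0 by apply: subst_ge.
have h1 : eval_monom m 1 <=s eval P 1 by apply: subst_ge.
have hw : eval_monom m (eval P 1)^oo <=s eval P (eval P 1)^oo.
  exact: subst_ge.
have [c cE] := eval_monomE m; move: h0 h1 hw; rewrite !cE eexp1 mul1r.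
have [->|e0] := eqVneq (m None) 0 => h0 h1 hw.
  rewrite eexp0 mul1r in h0.
  apply: natural_le_trans (natural_le_trans (inf_exp_le c) h0) _.
  exact: natural_le_addl.
apply: natural_le_trans (natural_le_trans hw (natural_le_addr _ _)).
(* Writes [c^oo] as the value of [c X^e] at [c^oo]; then [c^oo] is raised to [(eval P 1)^oo]. *)
rewrite -{1}[c^oo]mulr_inf_exp mulrC -{1}(eexp_inf_exp c e0).
apply: natural_leM (natural_le_refl _).
by apply: eexp_mono; apply: inf_exp_mono.
Qed.

(** Induction on the expression behind [D]: for each rule, the values at 1 and 0 and the derivative
    at 1 play the roles of [a], [a0] and [da] in the difference rules. *)
Lemma eval1_deriv P D :
  is_deriv None P D -> eval P 1 = eval P 0 + eval D 1.
Proof.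
elim=> {P D} [|||Y YX|P P' Q Q' _ IHP _ IHQ|P P' Q Q' _ IHP _ IHQ|P P' _ IH].
- by rewrite /eval !subst0 addr0.
- by rewrite /eval !subst1 subst0 addr0.
- by rewrite /eval subst1 !subst_var add0r.
- by rewrite /eval subst0 !subst_var addr0; case: Y YX.
- by rewrite /eval !(substD, substM); apply: add_eq_mul.
- by rewrite /eval !substD -!/(eval _ _) IHP IHQ addrACA.
- by rewrite /eval !(substM, subst_inf_exp); apply: add_eq_inf_exp.
Qed.

Lemma least_solution_eval0 P : least_solution P (eval P 0).
Proof.
split=> [|t tE]; last by rewrite tE; apply/eval_mono/natural_le0.
apply: natural_le_anti; first exact/eval_mono/natural_le0.
apply: natural_le_trans (eval_le_affine _ _) _.
by apply: natural_le_lub; [apply: natural_le_refl|apply: natural_le_mull].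
Qed.

Lemma greatest_solution_eval1 P :
  greatest_solution P (eval P 0 + (eval P 1)^oo).
Proof.
split=> [|t tE]; last first.
  apply: le_add_inf_exp => n.
  (* Keeping the factor [t] lets the induction unfold [t = P(t)] again; the resulting
     [P(0) * P(1)^n] is absorbed by [P(0)]. *)
  apply: (@natural_le_trans _ (eval P 0 + t * eval P 1 ^+ n)).
    elim: n => [|n IH]; first by rewrite mulr1; apply: natural_le_addr.
    apply: natural_le_trans IH _.
    apply: natural_le_lub; first exact: natural_le_addl.
    rewrite {1}tE exprS mulrA.
    apply: (@natural_le_trans _ ((eval P 0 + t * eval P 1) * eval P 1 ^+ n)).
      by apply: natural_leM (natural_le_refl _); apply: eval_le_affine.
    rewrite mulrDl; apply: natural_leD (natural_le_refl _).
    exact: natural_le_mull.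
  by apply: natural_leD; [apply: natural_le_refl|apply: natural_le_mulr].
apply: natural_le_anti.
  apply: natural_le_lub; first exact/eval_mono/natural_le0.
  apply: natural_le_trans (inf_exp_eval1_le _) _.
  apply: natural_le_lub; apply: eval_mono; first exact: natural_le0.
  exact: natural_le_addr.
apply: natural_le_trans (eval_le_affine _ _) _.
apply: natural_le_lub; [exact: natural_le_addl|exact: natural_le_mull].
Qed.

End Evaluation.

Theorem theorem34 (A : finType) (P : absPoly (option A)) :
  least_solution P (eval P 0) /\
  forall P' : absPoly (option A), is_deriv None P P' ->
    greatest_solution P (eval P 0 + (eval P' 1)^oo).
Proof.
split=> [|P' /eval1_deriv P'E]; first exact: least_solution_eval0.
suff <- : eval P 0 + (eval P 1)^oo = eval P 0 + (eval P' 1)^oo.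
  exact: greatest_solution_eval1.
have P0E : eval P 0 + (eval P 0)^oo = eval P 0.
  (* After commuting, the equation is by definition the inequality [(eval P 0)^oo <=s eval P 0]. *)
  by rewrite addrC; apply: inf_exp_le.
by rewrite P'E inf_expD addrA P0E.
Qed.
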